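(* Let $n\in\mathbb{N}$, let $\mathcal{A}$ be a complex Banach algebra with identity, and let $a,b,c,d\in\mathcal{A}$ satisfy $acd=dbd$ and $bdb=bac$. If $1-ac$ has a generalized $n$-strongly Drazin inverse, then $1-bd$ has a generalized $n$-strongly Drazin inverse.
   Context: $n$ is a fixed natural number, $\mathbb{N}=\{1,2,3,\dots\}$. $U(\mathcal{A})$ is the set of units of $\mathcal{A}$. For $a\in \mathcal{A}$, $\mathrm{comm}(a)=\{x\in \mathcal{A} : xa=ax\}$ and $\mathrm{comm}^2(a)=\{x\in \mathcal{A} : xy=yx \text{ for all } y\in \mathrm{comm}(a)\}$. Set $\mathcal{A}^{qnil}=\{a\in \mathcal{A} : 1+ax\in U(\mathcal{A})\text{ for every }x\in \mathrm{comm}(a)\}$; in a Banach algebra, $a\in\mathcal{A}^{qnil}$ if and only if $\lim_{k\to\infty}\|a^k\|^{1/k}=0$. An element $a\in \mathcal{A}$ has a generalized $n$-strongly Drazin inverse if there exists $x\in \mathcal{A}$ such that $xax=x$, $x\in \mathrm{comm}^2(a)$ and $a^n-ax\in \mathcal{A}^{qnil}$. *)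

(* Defs.v *)
From HB Require Import structures.
From mathcomp Require Import all_boot all_order all_algebra.
From mathcomp Require Import all_classical all_reals all_analysis.
From mathcomp Require Import complex.

Set Implicit Arguments.
Unset Strict Implicit.
Unset Printing Implicit Defensive.

Import GRing.Theory Num.Theory.
Import numFieldNormedType.Exports.

Local Open Scope classical_set_scope.
Local Open Scope ring_scope.

(* Unital Banach algebras over K. Hierarchy-Builder rejects a structure that
   joins CompleteNormedModule with a ring structure (the join with
   Num.NumDomain would be missing), so the ring operations and the algebra
   axioms are fields of the mixin, and the ring structure is then declared as
   an instance on every banachAlgType. Neither `|1| = 1 nor 1 != 0 is
   required. *)
HB.mixin Record CompleteNormedModule_isBanachAlgebra (K : numFieldType) A
    of CompleteNormedModule K A := {
  banach_one : A;
  banach_mul : A -> A -> A;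
  banach_mulA : associative banach_mul;
  banach_mul1 : left_id banach_one banach_mul;
  banach_mulr1 : right_id banach_one banach_mul;
  banach_mulDl : left_distributive banach_mul +%R;
  banach_mulDr : right_distributive banach_mul +%R;
  banach_scaleAl : forall (k : K) (x y : A),
    k *: banach_mul x y = banach_mul (k *: x) y;
  banach_scaleAr : forall (k : K) (x y : A),
    k *: banach_mul x y = banach_mul x (k *: y);
  banach_normM : forall x y : A, `|banach_mul x y| <= `|x| * `|y|
}.

#[short(type="banachAlgType")]
HB.structure Definition BanachAlgebra (K : numFieldType) :=
  {A of CompleteNormedModule K A & CompleteNormedModule_isBanachAlgebra K A}.

HB.instance Definition _ (K : numFieldType) (A : banachAlgType K) :=
  GRing.Zmodule_isPzRing.Build (BanachAlgebra.sort A)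
    banach_mulA banach_mul1 banach_mulr1 banach_mulDl banach_mulDr.

Section GeneralizedDrazin.
Variable A : pzRingType.
Implicit Types a x y : A.

Definition units : set A := [set a | exists b, a * b = 1 /\ b * a = 1].

Definition commutant a : set A := [set x | x * a = a * x].

Definition bicommutant a : set A :=
  [set x | forall y, commutant a y -> x * y = y * x].

Definition qnil : set A :=
  [set a | forall x, commutant a x -> units (1 + a * x)].

Definition has_gns_drazin_inverse (n : nat) a : Prop :=
  exists x, [/\ x * a * x = x, bicommutant a x & qnil (a ^+ n - a * x)].

End GeneralizedDrazin.

(* Main.v *)
Require Import Defs.
From mathcomp Require Import all_boot all_order all_algebra.
From mathcomp Require Import all_classical all_reals all_analysis.
From mathcomp Require Import complex.

Import GRing.Theory.
Local Open Scope ring_scope.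
Local Open Scope complex_scope.

(** The argument is algebraic and takes place in an arbitrary ring. Put
    [t = ac] and [alpha = 1 - t], let [x] be the given inverse of [alpha], and
    let [f = 1 - alpha x] be the complementary idempotent. On the range of [f]
    the element [alpha] is quasinilpotent, so [t] is invertible there; let [g]
    be its inverse on that range, extended by zero ([reciprocal_of_drazin]).
    Formally [g = psi(t)] with [psi(z) = phi(z) / z], where [phi] is [1] near
    [1] and [0] on the rest of the spectrum. Since [phi(bd) = psi(bd) b d] and
    [psi(bd) b = b psi(ac)], the idempotent of [1 - bd] that corresponds to [f]
    should be [b g d].

    What replaces functional calculus is the fact that [d y b] commutes
    with [ac] whenever [y] commutes with [bd] ([commutant_transfer]). It turns
    [g], which satisfies [g = g ac g], into an element [b g d] of the
    bicommutant of [bd] ([bicommutant_transfer]), and it shows, for every [k] in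
    the bicommutant of [ac], that [b k d] is quasinilpotent as soon as [ac k] is
    ([qnil_transfer]). With
    [k = g - (1 + alpha + ... + alpha^(n-1))] one gets both
    [ac k = alpha^n - alpha x] and [b k d = (1 - bd)^n - (1 - b g d)], hence
    the latter is quasinilpotent. An idempotent of the bicommutant that differs
    from an [n]-th power by a quasinilpotent element yields the inverse
    ([drazin_of_idempotent]). *)

(** * Units and bicommutants *)

Section Units.
Variable A : pzRingType.
Implicit Types x y z u : A.

Lemma units_of_left_right x y z : y * x = 1 -> x * z = 1 -> units x.
Proof.
move=> yx xz; exists z; split=> //.
by rewrite -[z]mul1r -yx -(mulrA y) xz mulr1.
Qed.

(** Jacobson's lemma: if [u] inverts [1 + xy], then [1 - y u x] inverts
    [1 + yx]. *)
Lemma units_jacobson x y : units (1 + x * y) -> units (1 + y * x).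
Proof.
move=> [u [xyu uxy]]; exists (1 - y * u * x); split.
  rewrite mulrDl mul1r mulrBr mulr1.
  have -> : y * x * (y * u * x) = y * ((1 + x * y) * u) * x - y * u * x.
    by rewrite mulrDl mul1r mulrDr mulrDl !mulrA addrC addKr.
  by rewrite xyu mulr1 opprB [y * x + _]addrC subrK subrK.
rewrite mulrDr mulr1 mulrBl mul1r.
have -> : y * u * x * (y * x) = y * (u * (1 + x * y)) * x - y * u * x.
  by rewrite mulrDr mulr1 mulrDr mulrDl !mulrA addrC addKr.
by rewrite uxy mulr1 opprB [y * x + _]addrC subrK subrK.
Qed.

Lemma units_of_sqr z : units (1 - z * z) -> units (1 + z).
Proof.
move=> [u [zu uz]].
have zzl : (1 - z) * (1 + z) = 1 - z * z.
  by rewrite mulrDr mulr1 mulrBl mul1r addrA subrK.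
have zzr : (1 + z) * (1 - z) = 1 - z * z.
  by rewrite mulrBr mulr1 mulrDl mul1r opprD addrA addrK.
apply: (@units_of_left_right _ (u * (1 - z)) ((1 - z) * u)).
  by rewrite -mulrA zzl.
by rewrite mulrA zzr.
Qed.

Lemma qnil_units z : qnil z -> units (1 + z).
Proof. by move=> /(_ 1); rewrite mulr1; apply; apply: commr_sym; apply: commr1. Qed.

End Units.

Section Bicommutant.
Variables (A : pzRingType) (a : A).
Implicit Types x y u : A.

Lemma bicommutant_id : bicommutant a a.
Proof. by move=> y /esym. Qed.

Lemma bicommutant1 : bicommutant a 1.
Proof. by move=> y _; rewrite mul1r mulr1. Qed.

Lemma bicommutantB x y :
  bicommutant a x -> bicommutant a y -> bicommutant a (x - y).
Proof. by move=> bx byy z cz; rewrite mulrBl mulrBr bx ?byy. Qed.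

Lemma bicommutantM x y :
  bicommutant a x -> bicommutant a y -> bicommutant a (x * y).
Proof. by move=> bx byy z cz; rewrite -mulrA byy // mulrA bx // mulrA. Qed.

Lemma bicommutantX x n : bicommutant a x -> bicommutant a (x ^+ n).
Proof.
by move=> bx z cz; apply/commr_sym/commrX/commr_sym/bx.
Qed.

Lemma bicommutant_geometric x n :
  bicommutant a x -> bicommutant a (\sum_(i < n) x ^+ i).
Proof.
move=> bx z cz; apply/commr_sym/commr_sum => i _.
by apply/commr_sym/bicommutantX.
Qed.

Lemma bicommutantV x u :
  x * u = 1 -> u * x = 1 -> bicommutant a x -> bicommutant a u.
Proof.
move=> xu ux bx z cz.
by rewrite -[u * z]mulr1 -xu mulrA -(mulrA u) -(bx _ cz) mulrA ux mul1r.
Qed.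

Lemma bicommutantC x y : bicommutant a x -> bicommutant a y -> x * y = y * x.
Proof. by move=> bx byy; apply: bx; apply: byy. Qed.

Lemma bicommutant_sub1 x : bicommutant (1 - a) x <-> bicommutant a x.
Proof.
split=> bx y cy; apply: bx; rewrite /commutant /=.
  by rewrite mulrBl mulrBr mul1r mulr1 cy.
move: cy; rewrite /commutant /= mulrBl mulrBr mul1r mulr1.
by move=> /addrI /oppr_inj.
Qed.

End Bicommutant.

(** * Inverses and idempotents *)

Section Idempotents.
Variable A : pzRingType.
Implicit Types t e f g beta : A.

(** Since [1 + (beta^n - e)] is a unit that agrees with [beta^n] on the range
    of [e], the product [e beta^(n-1) (1 + beta^n - e)^-1] inverts [beta] on
    this range. *)
Lemma drazin_of_idempotent n beta e : (0 < n)%N ->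
  e * e = e -> bicommutant beta e -> qnil (beta ^+ n - e) ->
  has_gns_drazin_inverse n beta.
Proof.
case: n => // n _ ee be qe.
have [u [zu uz]] := qnil_units A _ qe.
have bb := bicommutant_id A beta.
have bX m : bicommutant beta (beta ^+ m) by apply: bicommutantX.
have bu : bicommutant beta u.
  apply: bicommutantV zu uz _.
  rewrite addrCA -[1 - e]opprB.
  by apply: bicommutantB => //; apply: bicommutantB => //; apply: bicommutant1.
set x := e * beta ^+ n * u.
have bx : bicommutant beta x by do 2?apply: bicommutantM.
have betax : beta * x = e.
  rewrite /x !mulrA (bicommutantC _ _ _ _ bb be) -(mulrA e) -exprS.
  have -> : e * beta ^+ n.+1 = e * (1 + (beta ^+ n.+1 - e)).
    by rewrite mulrDr mulr1 mulrBr ee addrC subrK.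
  by rewrite -mulrA zu mulr1.
exists x; split=> //; last by rewrite betax.
by rewrite -mulrA betax (bicommutantC _ _ _ _ bx be) /x !mulrA ee.
Qed.

(** With [f = 1 - (1 - t) x] and [q = (1 - t)^n - (1 - t) x], the equality
    [f (1 - t)^n = f q] gives [t f (1 + ... + (1 - t)^(n-1)) = f (1 - f q)],
    where [1 - f q] is a unit because [q] is quasinilpotent and commutes with
    [f]. So [g = f (1 + ... + (1 - t)^(n-1)) (1 - f q)^-1] is the reciprocal of
    [t] on the range of [f], and [t g = f]. *)
Lemma reciprocal_of_drazin n t : has_gns_drazin_inverse n (1 - t) ->
  exists g, [/\ bicommutant t g, g * t * g = g &
                qnil ((1 - t) ^+ n - (1 - t * g))].
Proof.
move=> [x [xax /bicommutant_sub1 bx qq]].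
have bt := bicommutant_id A t.
set al := 1 - t in xax qq *.
have ba : bicommutant t al by apply: bicommutantB => //; apply: bicommutant1.
set e := al * x in qq *.
have be : bicommutant t e by apply: bicommutantM.
have ee : e * e = e by rewrite /e mulrA -(mulrA _ x) -mulrA xax.
set q := al ^+ n - e in qq *.
have bq : bicommutant t q by apply: bicommutantB => //; apply: bicommutantX.
set f := 1 - e.
have bf : bicommutant t f by apply: bicommutantB => //; apply: bicommutant1.
have ff : f * f = f by rewrite {1 3}/f mulrBl mul1r mulrBr mulr1 ee subrr subr0.
have fal : f * al ^+ n = f * q.
  by rewrite /q mulrBr [f * e]mulrBl mul1r ee subrr subr0.
have [u [zu uz]] : units (1 - f * q).
  have -> : 1 - f * q = 1 + q * - f by rewrite mulrN (bicommutantC _ _ _ _ bf bq).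
  by apply: qq; rewrite /commutant /= mulNr mulrN (bicommutantC _ _ _ _ bf bq).
have bu : bicommutant t u.
  apply: bicommutantV zu uz _; apply: bicommutantB; first exact: bicommutant1.
  exact: bicommutantM.
set s := \sum_(i < n) al ^+ i.
have ts : t * s = 1 - al ^+ n.
  by rewrite -opprB subrX1 -/s /al addrAC subrr sub0r mulNr opprK.
have bs : bicommutant t s by apply: bicommutant_geometric.
pose g := f * s * u.
have bg : bicommutant t g by do 2?apply: bicommutantM.
have tg : t * g = f.
  rewrite /g !mulrA (bicommutantC _ _ _ _ bt bf) -(mulrA f) ts.
  have -> : f * (1 - al ^+ n) = f * (1 - f * q).
    by rewrite mulrBr fal [RHS]mulrBr (mulrA f f q) ff.
  by rewrite -mulrA zu mulr1.
exists g; split=> //.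
  by rewrite -mulrA tg (bicommutantC _ _ _ _ bg bf) /g !mulrA ff.
by rewrite tg /f subKr.
Qed.

End Idempotents.

(** * Transfer from [ac] to [bd] *)

Section Transfer.
Variables (A : pzRingType) (a b c d : A).
Hypotheses (acd_dbd : a * c * d = d * b * d) (bdb_bac : b * d * b = b * a * c).
Implicit Types y k g : A.

Lemma commutant_transfer y :
  commutant (b * d) y -> commutant (a * c) (d * y * b).
Proof.
rewrite /commutant /= => cy.
rewrite !mulrA acd_dbd -2!(mulrA (d * y)) -bdb_bac.
have -> : d * y * (b * d * b) = d * (y * (b * d)) * b by rewrite !mulrA.
by rewrite cy !mulrA.
Qed.

Lemma commutant_db : commutant (a * c) (d * b).
Proof.
have := commutant_transfer 1; rewrite mulr1; apply.
by rewrite /commutant /= mul1r mulr1.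
Qed.

(** For [y] commuting with [bd], Jacobson's lemma moves [1 + ac (dyb)] to
    [1 + (bd)^2 y]; replacing [y] by [- y^2] makes this [1 - (bd y)^2]. *)
Lemma qnil_bd_of_ac : qnil (a * c) -> qnil (b * d).
Proof.
move=> qac y cy; apply: units_of_sqr.
have cyy : commutant (b * d) (- (y * y)).
  by rewrite /commutant /= mulNr mulrN -mulrA cy mulrA cy mulrA.
have := qac _ (commutant_transfer _ cyy).
have -> : a * c * (d * - (y * y) * b) = (d * b * d * - (y * y)) * b.
  by rewrite !mulrA acd_dbd.
move=> /units_jacobson.
suff -> : b * (d * b * d * - (y * y)) = - (b * d * y * (b * d * y)) by [].
rewrite !mulrN; congr (- _).
have -> : b * d * y * (b * d * y) = b * d * (y * (b * d)) * y.
  by rewrite !mulrA.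
by rewrite cy !mulrA.
Qed.

End Transfer.

Section WeightedTransfer.
Variables (A : pzRingType) (a b c d : A).
Hypotheses (acd_dbd : a * c * d = d * b * d) (bdb_bac : b * d * b = b * a * c).
Implicit Types y k g : A.

Lemma bicommutant_db k : bicommutant (a * c) k -> k * (d * b) = d * b * k.
Proof. by apply; apply: commutant_db. Qed.

(** The two relations between [a], [b], [c], [d] are inherited by [k a],
    [b k], [c], [d], because [k] commutes with [ac] and [db]. *)
Lemma qnil_transfer k :
  bicommutant (a * c) k -> qnil (a * c * k) -> qnil (b * k * d).
Proof.
move=> bk; have kdb := bicommutant_db _ bk.
have kac : k * (a * c) = a * c * k by apply: bk.
rewrite -kac mulrA; apply: qnil_bd_of_ac.
  have -> : k * a * c * d = k * (a * c * d) by rewrite !mulrA.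
  by rewrite acd_dbd mulrA kdb !mulrA.
have -> : b * k * d * (b * k) = b * (k * (d * b)) * k by rewrite !mulrA.
have -> : b * k * (k * a) * c = b * (k * (k * (a * c))) by rewrite !mulrA.
by rewrite kdb kac (mulrA k) kac !mulrA bdb_bac.
Qed.

Section Reflexive.
Variable g : A.
Hypotheses (bg : bicommutant (a * c) g) (gacg : g * (a * c) * g = g).

Let gg_ac : g * g * (a * c) = g.
Proof. by rewrite -mulrA (bg (a * c)) // mulrA gacg. Qed.

Let ac_gg : a * c * (g * g) = g.
Proof. by rewrite mulrA -(bg (a * c)) // gacg. Qed.

Lemma idempotent_transfer : b * g * d * (b * g * d) = b * g * d.
Proof.
have -> : b * g * d * (b * g * d) = b * g * (d * b * g) * d by rewrite !mulrA.
rewrite -(bicommutant_db _ bg).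
have -> : b * g * (g * (d * b)) * d = b * (g * g) * (d * b * d).
  by rewrite !mulrA.
rewrite -acd_dbd.
have -> : b * (g * g) * (a * c * d) = b * (g * g * (a * c)) * d.
  by rewrite !mulrA.
by rewrite gg_ac.
Qed.

(** Writing [g = g^2 (ac)] turns [b g d y] into [b g^2 d (bd) y], where [y]
    commutes with [bd]; then [g^2] crosses [d y b], and [g = (ac) g^2] absorbs
    the extra factor again. *)
Lemma bicommutant_transfer : bicommutant (b * d) (b * g * d).
Proof.
move=> y cy; have bgg : bicommutant (a * c) (g * g) by apply: bicommutantM.
have cdyb := commutant_transfer _ _ _ _ _ acd_dbd bdb_bac _ cy.
rewrite -{1}gg_ac.
have -> : b * (g * g * (a * c)) * d * y = b * (g * g) * (a * c * d) * y.
  by rewrite !mulrA.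
rewrite acd_dbd.
have -> : b * (g * g) * (d * b * d) * y = b * (g * g) * d * (b * d * y).
  by rewrite !mulrA.
rewrite -cy.
have -> : b * (g * g) * d * (y * (b * d)) = b * (g * g * (d * y * b)) * d.
  by rewrite !mulrA.
rewrite (bgg _ cdyb).
have -> : b * (d * y * b * (g * g)) * d = b * d * y * b * (g * g) * d.
  by rewrite !mulrA.
rewrite -cy.
have -> : y * (b * d) * b * (g * g) * d = y * (b * d * b) * (g * g) * d.
  by rewrite !mulrA.
rewrite bdb_bac.
have -> : y * (b * a * c) * (g * g) * d = y * (b * (a * c * (g * g)) * d).
  by rewrite !mulrA.
by rewrite ac_gg.
Qed.

End Reflexive.

(** Since [(1 - ac) d = d (1 - bd)], the sum can be moved to the right of [d],
    where it meets [bd] and telescopes. *)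
Lemma geometric_transfer n :
  b * (\sum_(i < n) (1 - a * c) ^+ i) * d = 1 - (1 - b * d) ^+ n.
Proof.
have powd i : (1 - a * c) ^+ i * d = d * (1 - b * d) ^+ i.
  elim: i => [|i IHi]; first by rewrite !expr0 mul1r mulr1.
  rewrite exprS -mulrA IHi mulrA mulrBl mul1r acd_dbd.
  by rewrite -(mulrA d b) -{1}[d]mulr1 -mulrBr -mulrA -exprS.
rewrite -mulrA mulr_suml.
under eq_bigr do rewrite powd.
rewrite -mulr_sumr mulrA.
by rewrite -[RHS]opprB subrX1 addrAC subrr sub0r mulNr opprK.
Qed.

Theorem drazin_transfer n : (0 < n)%N ->
  has_gns_drazin_inverse n (1 - a * c) -> has_gns_drazin_inverse n (1 - b * d).
Proof.
move=> n_gt0 /reciprocal_of_drazin [g [bg gacg qg]].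
have bal : bicommutant (a * c) (1 - a * c).
  by apply: bicommutantB; [apply: bicommutant1 | apply: bicommutant_id].
set s := \sum_(i < n) (1 - a * c) ^+ i.
have acs : a * c * s = 1 - (1 - a * c) ^+ n.
  by rewrite -opprB subrX1 -/s addrAC subrr sub0r mulNr opprK.
apply: (drazin_of_idempotent _ _ _ (1 - b * g * d)) => //.
- rewrite mulrBl mul1r mulrBr mulr1 idempotent_transfer //.
  by rewrite subrr subr0.
- apply/bicommutant_sub1/bicommutantB; first exact: bicommutant1.
  exact: bicommutant_transfer.
have -> : (1 - b * d) ^+ n - (1 - b * g * d) = b * (g - s) * d.
  by rewrite mulrBr mulrBl geometric_transfer !opprB addrCA.
apply: qnil_transfer.
  by apply: bicommutantB => //; apply: bicommutant_geometric.
by rewrite mulrBr acs opprB addrCA -[a * c * g - 1]opprB.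
Qed.

End WeightedTransfer.

Theorem theorem3p4 (R : realType) (A : banachAlgType R[i]) (n : nat)
    (n_gt0 : (0 < n)%N) (a b c d : A)
    (acd_dbd : a * c * d = d * b * d) (bdb_bac : b * d * b = b * a * c)
    (ac_drazin : has_gns_drazin_inverse n (1 - a * c)) :
  has_gns_drazin_inverse n (1 - b * d).
Proof. by apply: (drazin_transfer _ a b c d). Qed.
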